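(* Let $G$ be a group and let $H\le G$ be a subgroup of finite index. If $H$ is invariably generated (IG), then $G$ is invariably generated. Likewise, if $H$ is finitely invariably generated (FIG), then $G$ is finitely invariably generated.
   Context: Write $s^g = g^{-1}sg$. A subset $S$ of a group $G$ invariably generates $G$ if for every function $S\to G$, $s\mapsto g_s$, the set of conjugates $\{s^{g_s} : s\in S\}$ generates $G$. A group $G$ is invariably generated (IG) if it has an invariably generating subset; equivalently, if the subset $S=G$ invariably generates $G$. A group is finitely invariably generated (FIG) if it has a finite invariably generating subset. *)

(* Defs.v *)
From HB Require Import structures.
From mathcomp Require Import all_boot.
From mathcomp Require Import boolp classical_sets functions cardinality.

Set Implicit Arguments.
Unset Strict Implicit.
Unset Printing Implicit Defensive.

Import Algebra.
Local Open Scope classical_set_scope.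
Local Open Scope group_scope.

Section InvariableGeneration.
Variable G : groupType.
Implicit Types S H : set G.

Definition generated S : set G :=
  smallest (fun M : set G => group_closed (mem M)) S.

(* [x ^ y] is the conjugate [y^-1 * (x * y)]. *)
Definition invariably_generates S : Prop :=
  forall g : S -> G, generated (range (fun s : S => \val s ^ g s)) = [set: G].

Definition finite_index H : Prop :=
  finite_set (range (fun x : G => [set h * x | h in H])).

End InvariableGeneration.

Definition IG (G : groupType) : Prop :=
  exists S : set G, invariably_generates S.

Definition FIG (G : groupType) : Prop :=
  exists S : set G, finite_set S /\ invariably_generates S.

(* Main.v *)
From mathcomp Require Import all_fingroup finmap.
Require Import Defs.
From mathcomp Require Import all_boot.
From mathcomp Require Import boolp classical_sets functions cardinality.

(** Let [phi : G -> Q] be a morphism to a finite group whose kernel lies in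
    [H], given by the action of [G] on the cosets of [H].  If [S] invariably
    generates [H], then [S] together with a finite set [T] such that
    [phi T = phi G] invariably generates [G].

    Indeed, let [M] be generated by some conjugates of the elements of [S] and
    of [T].  The subgroup [phi M] of the finite group [phi G] meets every
    conjugacy class, because of [T], hence is equal to [phi G]
    ([class_support_eq_group]).  A conjugate [s ^ g] in [M] of [s] in [S] can
    then be corrected: [g = n * m] with [n] in the kernel, which lies in [H],
    and [m] in [M], so that [s ^ n] is in [M].  Thus [M] contains an
    [H]-conjugate of each element of [S], hence it contains [H], and in
    particular the kernel of [phi]; with [phi M = phi G] this gives
    [M = G]. *)

Set Implicit Arguments.
Unset Strict Implicit.

Local Open Scope classical_set_scope.
Local Open Scope group_scope.

(** A subgroup that meets every conjugacy class of a finite group is the whole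
    group (Jordan): otherwise its conjugates have too few nontrivial elements
    to cover the group. *)
Lemma class_support_eq_group (gT : finGroupType) (K L : {group gT}) :
  K \subset L -> L \subset class_support K L -> K :=: L.
Proof.
move=> sKL sLK; apply/eqP; rewrite finset.eqEsubset sKL /= -indexg_eq1.
have le_index : (#|K^# :^: L| <= #|L : K|)%N.
  rewrite card_conjugates normD1 -(leq_pmul2l (cardG_gt0 K)) Lagrange //.
  rewrite -[leqRHS](Lagrange (finset.subsetIl L 'N(K))) leq_mul2r.
  by rewrite subset_leq_card ?orbT // finset.subsetI sKL normG.
have le_cover : (#|L^#| <= #|K^# :^: L| * #|K^#|)%N.
  have -> : (#|K^# :^: L| * #|K^#| = \sum_(A in K^# :^: L) #|A|)%N.
    rewrite -sum_nat_const; apply: eq_bigr => A /imsetP[x _ ->].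
    by rewrite cardJg.
  apply: leq_trans (leq_card_cover _).
  by rewrite -class_supportD1 subset_leq_card // finset.setSD.
(* As #|L| = #|L : K| + #|K^#| * #|L : K|, the bound
   #|L| - 1 <= #|L : K| * #|K^#| leaves #|L : K| <= 1. *)
have le_card := leq_trans le_cover (leq_mul le_index (leqnn _)).
have := Lagrange sKL; rewrite (cardsD1 1 L) (cardsD1 1 K) !group1 => cardL.
rewrite eqn_leq indexg_gt0 andbT.
move: cardL; rewrite mulnDl mul1n => cardL.
by rewrite -(leq_add2r (#|K^#| * #|L : K|)) cardL leq_add2l mulnC.
Qed.

Lemma generated_group_closed (G : groupType) (S : set G) :
  group_closed (mem (generated S)).
Proof.
split; first by apply/mem_set => M [[M1 _] _]; exact: set_mem.
move=> x y /set_mem Sx /set_mem Sy; apply/mem_set => M MS.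
have [[_ Mdiv] _] := MS.
by apply/set_mem/Mdiv; apply/mem_set; [exact: Sx|exact: Sy].
Qed.

(** The direct image of a subgroup of an arbitrary group under a map to a
    finite group, as a finite set. *)
Definition fin_image (G : groupType) (gT : finGroupType) (phi : G -> gT)
    (M : set G) : {set gT} :=
  [set p | `[< exists2 x, M x & phi x = p >] ]%SET.

Lemma fin_imageP (G : groupType) (gT : finGroupType) (phi : G -> gT)
    (M : set G) (p : gT) :
  reflect (exists2 x, M x & phi x = p) (p \in fin_image phi M).
Proof. by rewrite inE; exact: asboolP. Qed.

Lemma morph_1 (G K : groupType) (phi : G -> K) :
  {morph phi : x y / x * y} -> phi 1 = 1.
Proof. by move=> phiM; apply: (mulgI (phi 1)); rewrite -phiM !mulg1. Qed.

Lemma morph_V (G K : groupType) (phi : G -> K) :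
  {morph phi : x y / x * y} -> {morph phi : x / x^-1}.
Proof.
move=> phiM x; apply: (mulgI (phi x)).
by rewrite -phiM !mulgV (morph_1 phiM).
Qed.

Lemma group_set_fin_image (G : groupType) (gT : finGroupType) (phi : G -> gT)
    (M : set G) :
    {morph phi : x y / x * y} -> group_closed (mem M) ->
  group_set (fin_image phi M).
Proof.
move=> phiM clM; apply/group_setP; split.
  by apply/fin_imageP; exists 1; [apply/set_mem; case: clM | exact: morph_1].
move=> _ _ /fin_imageP[x Mx <-] /fin_imageP[y My <-].
apply/fin_imageP; exists (x * y); last exact: phiM.
by apply/set_mem/(group_closedM clM); exact: mem_set.
Qed.

(** A subgroup of finite index contains the kernel of a morphism to a finite
    group, namely the action by right translation on its right cosets. *)
Lemma finite_index_morph (G : groupType) (A : set G) :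
    A 1 -> finite_index A ->
  exists (gT : finGroupType) (phi : G -> gT),
    {morph phi : x y / x * y} /\ forall x, phi x = 1 -> A x.
Proof.
rewrite /finite_index; set coset := (fun x : G => _) => A1 finA.
pose X : finType := fset_set (range coset).
have coset_in x : coset x \in fset_set (range coset).
  by rewrite in_fset_set //; apply/mem_set; exists x.
pose c x : X := FSetSub (coset_in x).
have cP x y : c x = c y -> coset x = coset y by move/(congr1 val).
have cE x y : coset x = coset y -> c x = c y by move=> e; apply: val_inj.
have c_surj (u : X) : exists x, c x = u.
  have := valP u; rewrite in_fset_set // => /set_mem[x _ e].
  by exists x; apply: val_inj.
have [r rK] := choice c_surj.
have cosetM x g : coset (x * g) = [set a * g | a in coset x].
  rewrite /coset image_comp; apply: eq_imagel => h _ /=.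
  by rewrite mulgA.
(* Since [coset x] determines [coset (x * g)], the result does not depend on
   the representative [r u] of [u]. *)
pose act g (u : X) := c (r u * g).
have actE g x : act g (c x) = c (x * g).
  by apply: cE; rewrite !cosetM (cP _ _ (rK (c x))).
have actM x y u : act (x * y) u = act y (act x u).
  by rewrite -(rK u) !actE mulgA.
have act1 u : act 1 u = u by rewrite -[u]rK actE mulg1.
have act_inj g : injective (act g).
  by apply: (can_inj (g := act g^-1)) => u; rewrite -actM mulgV act1.
exists {perm X}, (fun g => perm (act_inj g)); split=> [x y|x phi1].
  by apply/perm.permP => u; rewrite permM !permE actM.
(* An element acting trivially fixes the coset of [1], which is [A]. *)
have : c x = c 1 by rewrite -[x]mul1g -actE -(permE (act_inj x)) phi1 perm1.
move/cP => e; have : coset x x by exists 1; rewrite ?mul1g.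
by rewrite e => -[h Ah]; rewrite mulg1 => <-.
Qed.

(** The finite set [T] contains a preimage of each element of the image of [G]
    in a finite group, under a morphism with kernel inside [P]. *)
Lemma invariably_generates_finite_index (G : groupType) (P : pred G)
    (H : subGroupType P) (S : set H) :
    finite_index [set` P] -> invariably_generates S ->
  exists2 T : set G, finite_set T &
    invariably_generates ((\val : H -> G) @` S `|` T).
Proof.
move=> finP genS.
have P1 : P 1 by rewrite -(val1 H); exact: valP.
have [gT [phi [phiM kerP]]] := finite_index_morph P1 finP.
have phiV := morph_V phiM.
have [t tP] : {t : gT -> G & forall p, (exists y, phi y = p) -> phi (t p) = p}.
  apply: (@choice _ _ (fun p x => (exists y, phi y = p) -> phi x = p)) => p.
  have [[y yp]|no] := pselect (exists y, phi y = p); first by exists y.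
  by exists 1.
exists (range t); first exact/finite_image/finite_finset.
set U := _ `|` _ => g; set M := generated _.
have clM : group_closed (mem M) := generated_group_closed _.
have M1 : M 1 by apply/set_mem; case: clM.
have MM x y : M x -> M y -> M (x * y).
  by move=> Mx My; apply/set_mem/(group_closedM clM); exact: mem_set.
have MV x : M x -> M x^-1.
  by move=> Mx; apply/set_mem/(group_closedV clM); exact: mem_set.
have MU x : U x -> exists y, M (x ^ y).
  move=> Ux; exists (g (SigSub (mem_set Ux))).
  by apply: sub_gen_smallest; exists (SigSub (mem_set Ux)).
have clT : group_closed (mem [set: G]) by split=> [|x y _ _]; apply: mem_set.
pose K := group (group_set_fin_image phiM clM).
pose L := group (group_set_fin_image phiM clT).
have phi_M x : exists2 m, M m & phi m = phi x.
  suff eqKL : K :=: L.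
    apply/fin_imageP; rewrite -[fin_image _ _]/(gval K) eqKL.
    by apply/fin_imageP; exists x.
  apply: class_support_eq_group; apply/fintype.subsetP => p.
    by case/fin_imageP=> y _ <-; apply/fin_imageP; exists y.
  case/fin_imageP=> y _ yp.
  have phit : phi (t p) = p by apply: tP; exists y.
  have [z Mz] : exists z, M (t p ^ z) by apply: MU; right; exists p.
  apply/imset2P; exists (phi (t p ^ z)) (phi z)^-1; last 1 first.
  - by rewrite !conjgE !phiM !phiV phit invgK !mulgA mulgV mul1g mulgK.
  - by apply/fin_imageP; exists (t p ^ z).
  - by rewrite groupV; apply/fin_imageP; exists z.
(* The given conjugator [z] of [s] is [n * m], with [n = z / m] in the kernel
   of [phi]; conjugating by [m^-1] stays inside [M]. *)
have SM (s : S) : exists h : H, M (\val (\val s ^ h)).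
  have [z Mz] : exists z, M ((\val (\val s) : G) ^ z).
    by apply: MU; left; exists (\val s) => //; exact/set_mem/valP.
  have [m Mm phim] := phi_M z.
  have Pn : P (z / m) by apply: kerP; rewrite phiM phiV phim mulgV.
  pose n : H := Sub (z / m) Pn; have valn : \val n = z / m := SubK H Pn.
  exists n; have -> : \val (\val s ^ n) = (\val (\val s) ^ z) ^ m^-1.
    by rewrite -conjgM !conjgE !gmulfM gmulfV /= valn.
  by rewrite conjgE invgK; apply: (MM) => //; apply: (MM) => //; exact: MV.
have [h hP] := choice SM.
(* The elements of [H] whose value is in [M] form a subgroup of [H] containing
   conjugates in [H] of all the elements of [S]. *)
have PM x : P x -> M x.
  move=> Px; have : generated (range (fun s : S => \val s ^ h s)) (Sub x Px).
    by rewrite genS.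
  move=> /(_ [set y | M (\val y)]) /=; rewrite SubK; apply; split.
    split; first by apply/mem_set; rewrite /= gmulf1; exact: M1.
    move=> y z /set_mem My /set_mem Mz; apply/mem_set.
    by rewrite /= gmulfM gmulfV; apply: (MM) => //; exact: MV.
  by move=> _ [s _ <-]; exact: hP.
apply/seteqP; split=> // x _; have [m Mm phim] := phi_M x.
have Mxm : M (x / m) by apply: PM; apply: kerP; rewrite phiM phiV phim mulgV.
by rewrite -(mulgVK m x); exact: MM.
Qed.

Unset Implicit Arguments.
Set Strict Implicit.

(* [H] is the group carried by the subgroup of [G] with membership predicate [P]. *)
Theorem theorem1 (G : groupType) (P : pred G) (H : subGroupType P)
    (hH : finite_index [set` P]) :
  (IG H -> IG G) /\ (FIG H -> FIG G).
Proof.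
split=> [[S genS]|[S [finS genS]]];
    have [T finT genT] := invariably_generates_finite_index hH genS.
  by eexists; exact: genT.
eexists; split; last exact: genT.
by rewrite finite_setU; split=> //; exact: finite_image.
Qed.
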